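(* Let $\mu\in\mathbb{N}_+$ and assume that $\mathbf p(t)\in V_\mu$ is the unique solution of the mean-field ODE system. Let $K>1$ be the fixed constant described in the context (exponential moments), and define the time $t_*$ such that for all $t\ge t_*$ $$\frac{r^*}{\bar r(t)}\le\frac{1+K}{2}\quad\text{and}\quad\frac{\bar r(t)}{r^*}\le\frac{1+K}{2}.$$ Then for all $t\ge t_*$ $$\mathrm H\le C\,\mathrm D\,|\log(1/\mathrm D)|$$ for some positive constant $C$ independent of $t$. Consequently, there exists some $C>0$ such that $$\mathrm H=\mathrm D_{\mathrm{KL}}(\mathbf p(t)\,\|\,\mathbf p^* )\le C\,e^{-C\sqrt t}$$ whenever $t\ge t_*$. In particular, this last bound holds for all $t>0$ (with a possibly different constant $C>0$).
   Context: Mean-field ODE system: for a sequence $\mathbf p=(p_n)_{n\ge0}$ put $\bar r=1-p_0$. The system is $$p_0'=p_1-\bar r\,p_0,\qquad p_n'=p_{n+1}+\bar r\,p_{n-1}-(1+\bar r)p_n\quad(n\ge1).$$ $V_\mu=\{\mathbf p: p_n\ge0,\ \sum_{n\ge0}p_n=1,\ \sum_{n\ge0}np_n=\mu\}$; solutions starting in $V_\mu$ stay in $V_\mu$. The unique equilibrium in $V_\mu$ is the geometric distribution $p_n^*=p_0^*(r^* )^n$ with $p_0^*=1-r^*=\frac1{1+\mu}$. Exponential moments: $K>1$ denotes a fixed constant with the property that $\sup_{t>0}\sum_{n\ge0}K^np_n(t)<\infty$ if $\sum_{n\ge0}K^np_n(0)$ is finite (such a $K$ exists). The relative entropy is $\mathrm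 H=\mathrm D_{\mathrm{KL}}(\mathbf p\|\mathbf p^* )=\sum_{n\ge0}p_n\log\frac{p_n}{p_n^*}$, and the entropy dissipation, for which $\frac{d}{dt}\mathrm H=-\mathrm D$, is $$\mathrm D=\sum_{n\ge0}(\bar r\,p_n-p_{n+1})\bigl(\log(\bar r\,p_n)-\log p_{n+1}\bigr).$$ The letter $C$ is a generic constant that may differ between occurrences.
   Formalization: The bound is proved as H ≤ C D max(1,|log(1/D)|), since H ≤ C D |log(1/D)| fails at times when D = 1 and H > 0; and the sum of K^n p_n(0) is explicitly assumed finite, since for heavy-tailed initial data the decay bound is false. *)

(* Defs.v *)
From HB Require Import structures.
From mathcomp Require Import all_boot all_order all_algebra.
From mathcomp Require Import all_classical all_reals all_analysis.

Set Implicit Arguments.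
Unset Strict Implicit.
Unset Printing Implicit Defensive.

Import Order.TTheory GRing.Theory Num.Theory.
Import numFieldNormedType.Exports.

Local Open Scope classical_set_scope.
Local Open Scope ring_scope.

Definition rbar (R : realType) (p : nat -> R) : R := 1 - p 0%N.

(* A time-dependent sequence is [p : R -> nat -> R], with [p t n] = p_n(t).
   Only times t >= 0 matter: the ODE is imposed at t > 0 and each component is
   continuous on [0, +oo[; since the right-hand side is a polynomial in finitely
   many components, this is the same as being C^1 on [0, +oo[ with the one-sided
   derivative at 0. *)
Definition mean_field_solution (R : realType) (p : R -> nat -> R) : Prop :=
  (forall n : nat, {within `[0, +oo[, continuous (fun t : R => p t n)}) /\
  (forall t : R, 0 < t ->
    is_derive t 1 (fun s : R => p s 0%N) (p t 1%N - rbar (p t) * p t 0%N) /\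
    forall n : nat, is_derive t 1 (fun s : R => p s n.+1)
      (p t n.+2 + rbar (p t) * p t n - (1 + rbar (p t)) * p t n.+1)).

Definition V (R : realType) (mu : nat) (p : nat -> R) : Prop :=
  [/\ forall n : nat, 0 <= p n,
      (\sum_(0 <= n <oo) (p n)%:E = 1)%E &
      (\sum_(0 <= n <oo) (n%:R * p n)%:E = mu%:R%:E)%E].

Definition pstar0 (R : realType) (mu : nat) : R := 1 / (1 + mu%:R).

Definition rstar (R : realType) (mu : nat) : R := 1 - pstar0 R mu.

Definition pstar (R : realType) (mu : nat) (n : nat) : R :=
  pstar0 R mu * rstar R mu ^+ n.

Definition exp_moment (R : realType) (K : R) (p : nat -> R) : \bar R :=
  (\sum_(0 <= n <oo) (K ^+ n * p n)%:E)%E.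

Definition propagates_exp_moment (R : realType) (K : R) (p : R -> nat -> R) :
    Prop :=
  (exp_moment K (p 0%R) < +oo)%E ->
  (ereal_sup [set exp_moment K (p t) | t in [set t : R | (0 < t)%R]] < +oo)%E.

(* Since [lne 0 = -oo], [x / 0 = +oo] for x > 0 and [0 * x = 0] for every
   extended real x, the usual conventions 0 log (0 / q) = 0 and
   p log (p / 0) = +oo for p > 0 hold. *)
Definition relative_entropy (R : realType) (p q : nat -> R) : \bar R :=
  (\sum_(0 <= n <oo) ((p n)%:E * lne ((p n)%:E / (q n)%:E)))%E.

(* A term (a - b)(log a - log b) is +oo when exactly one of a, b >= 0 vanishes,
   and 0 when both do. *)
Definition dissipation (R : realType) (p : nat -> R) : \bar R :=
  (\sum_(0 <= n <oo)
     ((rbar p * p n - p n.+1)%:E *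
      (lne (rbar p * p n)%:E - lne (p n.+1)%:E)))%E.

Definition is_tstar (R : realType) (mu : nat) (K : R) (p : R -> nat -> R)
    (tstar : R) : Prop :=
  0 <= tstar /\
  forall t : R, tstar <= t ->
    rstar R mu / rbar (p t) <= (1 + K) / 2 /\
    rbar (p t) / rstar R mu <= (1 + K) / 2.

(* Main.v *)
Require Import Defs.
From HB Require Import structures.
From mathcomp Require Import all_boot all_order all_algebra.
From mathcomp Require Import all_classical all_reals all_analysis.
From mathcomp Require Import ring lra.

Set Implicit Arguments.
Unset Strict Implicit.
Unset Printing Implicit Defensive.

Import Order.TTheory GRing.Theory Num.Theory.
Import numFieldNormedType.Exports.

Local Open Scope classical_set_scope.
Local Open Scope ring_scope.

(**
Let r = 1 - p_0, let g be the geometric law g_n = (1 - r) r^n, and let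
E_N be the sum over n < N of (sqrt (r p_n) - sqrt p_{n+1})^2, so that 2 E_N <= D.
The deviation w_n = sqrt p_n - sqrt g_n vanishes at n = 0 and satisfies
w_{n+1} = sqrt r w_n + e_n with e_n a term of E_N (up to sign), hence the sum of
w_n^2 over n <= N is at most E_N / (1 - sqrt r)^2. Since p_n <= 1, the n-th term
p log (p / g) - p + g of the entropy relative to g is at most C (n + 1) w_n^2, and
entropy relative to p* is at most entropy relative to g, because the means agree
for p and p*. With the exponential tails this gives, for every cutoff N,
H <= C ((N + 1) E_N + q^N). The computation needs r away from 0 and 1; this
holds as soon as E_N + q^N is small, because the mean of the flux r p_n - p_{n+1}
is (mu + 1) r - mu, and otherwise H is bounded by a multiple of E_N + q^N anyway.

Taking N of order log (1/D) yields the entropy-dissipation inequality. For the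
decay, the truncated entropy H_N satisfies H_N' <= - 2 E_N + C q^N, hence
H_N' <= - c H_N / (N + 1) + C q^N; integrating this linear inequality over
[t/2, t] and taking N of order sqrt t gives the rate exp (- C sqrt t).
*)

(** * Elementary inequalities for the logarithm and the square root *)

Lemma eqW_ler (R : numDomainType) (x y : R) : x = y -> x <= y.
Proof. by move=> ->. Qed.

Lemma ler_lnB1 (R : realType) (x : R) : 0 < x -> ln x <= x - 1.
Proof.
by move=> x0; have := @le_ln1Dx R (x - 1); rewrite addrCA subrr addr0; apply; lra.
Qed.

Lemma ler_lnV (R : realType) (x : R) : 0 < x -> 1 - x^-1 <= ln x.
Proof.
move=> x0; have := @ler_lnB1 R x^-1; rewrite invr_gt0 => /(_ x0).
by rewrite lnV ?posrE//; lra.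
Qed.

(** With s = sqrt (a / b), division by b leaves 2 s^2 ln s - s^2 + 1 against (s - 1)^2. For s <= 2,
    ln s <= s - 1 gives the factor 2 s + 1 <= 5; for s > 2, 2 ln s <= L and s <= 2 (s - 1) give 4
    L. *)
Lemma kl_le_hellinger (R : realType) (a b L : R) :
  0 <= a -> 0 < b -> 0 <= L -> a <= b * expR L ->
  a * ln (a / b) - a + b <= (5 + 4 * L) * (Num.sqrt a - Num.sqrt b) ^+ 2.
Proof.
move=> a0 b0 L0 aL; set x := Num.sqrt a; set y := Num.sqrt b.
have y0 : 0 < y by rewrite sqrtr_gt0.
have yb : b = y ^+ 2 by rewrite sqr_sqrtr// ltW.
have xa : a = x ^+ 2 by rewrite sqr_sqrtr.
have [az|an] := eqVneq a 0.
  have x0 : x = 0 by rewrite /x az sqrtr0.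
  by rewrite x0 az yb; nra.
have ap : 0 < a by rewrite lt_def an.
have x0 : 0 < x by rewrite sqrtr_gt0.
set s := x / y; have s0 : 0 < s by rewrite divr_gt0.
have xs : x = s * y by rewrite /s divfK// gt_eqF.
have lnab : ln (a / b) = 2 * ln s.
  by rewrite xa yb -expr_div_n lnXn// mulr_natl.
have lnL : 2 * ln s <= L.
  rewrite -lnab -[leRHS]expRK ler_ln ?posrE ?divr_gt0 ?expR_gt0//.
  by rewrite ler_pdivrMr// mulrC.
have l1 : ln s <= s - 1 by exact: ler_lnB1.
have key : 2 * s ^+ 2 * ln s - s ^+ 2 + 1 <= (5 + 4 * L) * (s - 1) ^+ 2.
  have [s2|s2] := leP s 2.
    have h : 2 * s ^+ 2 * ln s <= 2 * s ^+ 2 * (s - 1).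
      by rewrite ler_pM2l// mulr_gt0// exprn_gt0.
    have h2 : (2 * s + 1) * (s - 1) ^+ 2 <= 5 * (s - 1) ^+ 2.
      by rewrite ler_wpM2r ?sqr_ge0//; lra.
    have h3 : 0 <= 4 * L * (s - 1) ^+ 2 by rewrite mulr_ge0 ?sqr_ge0//; lra.
    have h4 : 2 * s ^+ 2 * (s - 1) - s ^+ 2 + 1 = (2 * s + 1) * (s - 1) ^+ 2 by ring.
    by lra.
  have h : s ^+ 2 * (2 * ln s) <= s ^+ 2 * L by rewrite ler_pM2l// exprn_gt0.
  have h2 : s ^+ 2 * L <= 4 * (s - 1) ^+ 2 * L by rewrite ler_wpM2r//; nra.
  have h3 : 0 <= 5 * (s - 1) ^+ 2 by rewrite mulr_ge0 ?sqr_ge0.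
  by nra.
have y20 : 0 <= y ^+ 2 by exact: sqr_ge0.
have := ler_wpM2r y20 key.
rewrite lnab xa yb xs.
set l := ln s; move: l => l h.
apply: le_trans (_ : (2 * s ^+ 2 * l - s ^+ 2 + 1) * y ^+ 2 <= _).
  by apply: eqW_ler; ring.
by apply: le_trans h _; apply: eqW_ler; ring.
Qed.

(** For a <= b with roots x <= y, the bound ln y - ln x >= (y - x) / y makes the right side at least
    2 (y - x)^2 (1 + x / y). The other case follows by symmetry. *)
Lemma hellinger_le_dissipation (R : realType) (a b : R) : 0 < a -> 0 < b ->
  2 * (Num.sqrt a - Num.sqrt b) ^+ 2 <= (a - b) * (ln a - ln b).
Proof.
suff W (x y : R) : 0 < x -> 0 < y -> x <= y ->
    2 * (Num.sqrt x - Num.sqrt y) ^+ 2 <= (x - y) * (ln x - ln y).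
  move=> a0 b0; have [ab|/ltW ba] := leP a b; first exact: W.
  rewrite -sqrrN opprB; apply: le_trans (W _ _ b0 a0 ba) _.
  by apply: eqW_ler; ring.
move: x y => {}a {}b a0 b0 ab; set x := Num.sqrt a; set y := Num.sqrt b.
have xa : a = x ^+ 2 by rewrite sqr_sqrtr// ltW.
have yb : b = y ^+ 2 by rewrite sqr_sqrtr// ltW.
have x0 : 0 < x by rewrite sqrtr_gt0.
have y0 : 0 < y by rewrite sqrtr_gt0.
have xy : x <= y by rewrite ler_wsqrtr.
have l : (y - x) / y <= ln y - ln x.
  rewrite -ln_div// (le_trans _ (ler_lnV _)) ?divr_gt0//.
  by apply: eqW_ler; field; rewrite !gt_eqF.
rewrite xa yb (lnXn 2 x0) (lnXn 2 y0) -(mulr_natl (ln x)) -(mulr_natl (ln y)).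
have e : (x ^+ 2 - y ^+ 2) * (2 * ln x - 2 * ln y) =
   2 * ((y - x) * (x + y) * (ln y - ln x)) by ring.
rewrite e ler_pM2l//.
apply: le_trans (_ : (y - x) * (x + y) * ((y - x) / y) <= _).
  have -> : (y - x) * (x + y) * ((y - x) / y) = (x - y) ^+ 2 * (1 + x / y).
    by field; rewrite gt_eqF.
  rewrite ler_peMr ?sqr_ge0// lerDl divr_ge0// ltW//.
by rewrite ler_wpM2l// mulr_ge0 ?subr_ge0// addr_ge0// ltW.
Qed.

(** * Finite sums: geometric tails, an affine recursion, summation by parts *)

Lemma sum_geometric_tail (R : realType) (f : nat -> R) (A q : R) (N k : nat) :
  q < 1 -> (forall n, f n <= A * q ^+ n) ->
  \sum_(i < N + k) f i <=
    \sum_(i < N) f i + A / (1 - q) * (q ^+ N - q ^+ (N + k)).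
Proof.
move=> q1 fA; elim: k => [|k ih]; first by rewrite addn0 subrr mulr0 addr0.
rewrite addnS big_ord_recr/= (le_trans (lerD ih (fA _)))//.
by apply: eqW_ler; rewrite exprS; field; lra.
Qed.

Lemma sum_geometric_le (R : realType) (f : nat -> R) (A q : R) (N : nat) :
  0 < q -> q < 1 -> 0 <= A -> (forall n, f n <= A * q ^+ n) ->
  \sum_(i < N) f i <= A / (1 - q).
Proof.
move=> q0 q1 A0 fA; have := sum_geometric_tail 0 N q1 fA.
rewrite big_ord0 add0r add0n expr0 => /le_trans; apply.
rewrite ler_piMr//; first by rewrite divr_ge0//; lra.
by rewrite gerBl exprn_ge0// ltW.
Qed.

(* A discrete Hardy inequality: the recursion contracts with ratio [s]. *)
Lemma sum_sqr_affine_rec (R : realType) (w e : nat -> R) (s : R) (N : nat) :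
  0 <= s -> s < 1 -> w 0%N = 0 -> (forall n, w n.+1 = s * w n + e n) ->
  (1 - s) ^+ 2 * \sum_(i < N.+1) w i ^+ 2 <= \sum_(i < N) e i ^+ 2.
Proof.
move=> s0 s1 w0 wS.
have d0 : 0 < 1 - s by lra.
(* Convexity of the square with weights s and 1 - s: the two sides differ by s ((1 - s) x - y)^2. *)
have st n : (1 - s) * w n.+1 ^+ 2 <= s * (1 - s) * w n ^+ 2 + e n ^+ 2.
  rewrite wS; set x := w n; set y := e n.
  have : 0 <= s * ((1 - s) * x - y) ^+ 2 by rewrite mulr_ge0 ?sqr_ge0.
  by nra.
have : (1 - s) * \sum_(i < N.+1) w i ^+ 2 <=
    s * (1 - s) * \sum_(i < N) w i ^+ 2 + \sum_(i < N) e i ^+ 2.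
  rewrite big_ord_recl/= w0 expr0n/= add0r !mulr_sumr -big_split/=.
  by apply: ler_sum => i _; exact: st.
rewrite big_ord_recr/=; set X := \sum_(i < N) w i ^+ 2.
have : 0 <= w N ^+ 2 by exact: sqr_ge0.
have : 0 <= s * (1 - s) by apply: mulr_ge0 => //; lra.
by nra.
Qed.

Lemma sum_flux_by_parts (R : realType) (J x : nat -> R) (N : nat) :
  - J 0%N * x 0%N + \sum_(n < N) (J n - J n.+1) * x n.+1 =
  \sum_(n < N) J n * (x n.+1 - x n) - J N * x N.
Proof.
elim: N => [|N ih]; first by rewrite !big_ord0; ring.
by rewrite !big_ord_recr/= addrA ih; ring.
Qed.

(** * Laws of fixed mean with geometric tails *)

(* All that is used of a law of mean [mu] with a bounded exponential moment. *)
Definition controlled (R : realType) (mu : nat) (A q : R) (p : nat -> R) : Prop :=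
  [/\ forall n, 0 <= p n,
      forall n, n.+1%:R ^+ 2 * p n <= A * q ^+ n,
      forall n, - (p n * ln (p n)) <= A * q ^+ n,
      forall N, 0 <= 1 - \sum_(n < N) p n <= A * q ^+ N &
      forall N, 0 <= mu%:R - \sum_(n < N) n%:R * p n <= A * q ^+ N].

Definition partial_entropy (R : realType) (mu : nat) (p : nat -> R) (N : nat) : R :=
  \sum_(n < N) p n * ln (p n / pstar R mu n).

(** This is E_N of the overview, a real quantity even where [dissipation] is infinite. *)
Definition defect (R : realType) (p : nat -> R) (N : nat) : R :=
  \sum_(n < N) (Num.sqrt (rbar p * p n) - Num.sqrt (p n.+1)) ^+ 2.

Lemma defect_ge0 (R : realType) (p : nat -> R) (N : nat) : 0 <= defect p N.
Proof. by apply: sumr_ge0 => i _; exact: sqr_ge0. Qed.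

Lemma controlled_le1 (R : realType) mu (A q : R) p :
  controlled mu A q p -> forall n, p n <= 1.
Proof.
move=> [p0 _ _ h _] n; have /andP[+ _] := h n.+1.
rewrite big_ord_recr/=.
have : 0 <= \sum_(i < n) p i by apply: sumr_ge0 => i _.
by lra.
Qed.

Lemma controlled_rbar (R : realType) mu (A q : R) p :
  controlled mu A q p -> 0 <= rbar p <= 1.
Proof.
move=> cp; have := controlled_le1 cp 0; case: cp => p0 _ _ _ _.
by have := p0 0%N; rewrite /rbar; lra.
Qed.

Lemma pstar0_gt0 (R : realType) mu : 0 < pstar0 R mu.
Proof. by rewrite /pstar0 divr_gt0// ltr_pwDl. Qed.

Lemma rstar_gt0 (R : realType) mu : (0 < mu)%N -> 0 < rstar R mu.
Proof.
move=> mu0; have m1 : (1 : R) <= mu%:R by rewrite ler1n.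
rewrite /rstar /pstar0 subr_gt0 ltr_pdivrMr; lra.
Qed.

Lemma pstar_gt0 (R : realType) mu n : (0 < mu)%N -> 0 < pstar R mu n.
Proof. by move=> mu0; rewrite mulr_gt0 ?pstar0_gt0// exprn_gt0// rstar_gt0. Qed.

Lemma ln_pstar (R : realType) mu n : (0 < mu)%N ->
  ln (pstar R mu n) = ln (pstar0 R mu) + n%:R * ln (rstar R mu).
Proof.
move=> mu0; have r0 := rstar_gt0 R mu0.
rewrite /pstar lnM ?posrE ?exprn_gt0 ?pstar0_gt0//.
by rewrite lnXn// mulr_natl.
Qed.

Lemma Nln_pstar_bounds (R : realType) mu n : (0 < mu)%N ->
  0 <= - ln (pstar R mu n) <= ln (1 + mu%:R) * n.+1%:R.
Proof.
move=> mu0; have m1 : (1 : R) <= mu%:R by rewrite ler1n.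
rewrite ln_pstar//.
have -> : rstar R mu = mu%:R / (1 + mu%:R) by rewrite /rstar /pstar0; field; lra.
have -> : pstar0 R mu = (1 + mu%:R)^-1 by rewrite /pstar0 div1r.
rewrite lnV ?ln_div ?posrE; [|lra..].
have n0 : 0 <= n%:R :> R by [].
have l1 : 0 <= ln (mu%:R : R) by exact: ln_ge0.
have l2 : ln (mu%:R : R) <= ln (1 + mu%:R) by rewrite ler_ln ?posrE; lra.
rewrite -natr1.
set a := ln _ in l1 l2 *; set b := ln _ in l2 *.
have : 0 <= n%:R * (b - a) by apply: mulr_ge0 => //; lra.
have : 0 <= n%:R * a by apply: mulr_ge0.
have : 0 <= b by lra.
by lra.
Qed.

(** [controlled] bounds p_n ln p_n directly; - ln (pstar n) grows only linearly in n, which the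
    weight (n + 1)^2 on p_n absorbs. *)
Lemma entropy_term_bounds (R : realType) mu (A q : R) p n : (0 < mu)%N ->
  controlled mu A q p ->
  `|p n * ln (p n / pstar R mu n)| <= (1 + ln (1 + mu%:R)) * A * q ^+ n.
Proof.
move=> mu0 cp; have p1 := controlled_le1 cp n.
have := Nln_pstar_bounds R n mu0; set k := ln (1 + _) => /andP[s0 s1].
have k0 : 0 <= k by apply: ln_ge0; rewrite lerDl.
have sp := pstar_gt0 R n mu0.
case: cp => p0 pA pl _ _.
have Aq0 : 0 <= A * q ^+ n by apply: le_trans (pA n); rewrite mulr_ge0// sqr_ge0.
have [pz|pn] := eqVneq (p n) 0.
  by rewrite pz mul0r normr0 -mulrA mulr_ge0//; lra.
have pp : 0 < p n by rewrite lt_def pn p0.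
have lp : ln (p n) <= 0 by exact: ln_le0.
rewrite ln_div ?posrE// mulrBr.
have h1 : 0 <= p n * - ln (pstar R mu n) by apply: mulr_ge0.
have h2 : p n * - ln (pstar R mu n) <= k * (A * q ^+ n).
  apply: le_trans (_ : p n * (k * n.+1%:R) <= _); first by rewrite ler_wpM2l.
  rewrite mulrCA ler_wpM2l// (le_trans _ (pA n))// mulrC ler_wpM2r//.
  by rewrite expr2 ler_peMr// ler1n.
have h3 := pl n.
have h4 : p n * ln (p n) <= 0 by rewrite mulr_ge0_le0.
by rewrite ler_norml; nra.
Qed.

(** This bound is uniform in [N]. It serves when the defect is not small, and as the starting value
    when the decay is integrated in time. *)
Lemma partial_entropy_le (R : realType) mu (A q : R) p N : (0 < mu)%N ->
  0 < q -> q < 1 -> 0 <= A -> controlled mu A q p ->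
  partial_entropy mu p N <= (1 + ln (1 + mu%:R)) * A / (1 - q).
Proof.
move=> mu0 q0 q1 A0 cp.
apply: (@sum_geometric_le R (fun n => p n * ln (p n / pstar R mu n))) => //.
  rewrite mulr_ge0// addr_ge0// ln_ge0//.
  by rewrite lerDl.
by move=> n; apply: le_trans (ler_norm _) (entropy_term_bounds _ mu0 cp).
Qed.

(** Over all n the sum would be (mu + 1) r - mu, which vanishes at the equilibrium; the other terms
    on the right are tails that [controlled] bounds. *)
Lemma sum_mean_flux (R : realType) mu (p : nat -> R) N :
  \sum_(n < N) n.+1%:R * (rbar p * p n - p n.+1) =
  (mu%:R + 1) * rbar p - mu%:R
  - rbar p * ((mu%:R - \sum_(n < N) n%:R * p n) + (1 - \sum_(n < N) p n))
  + (mu%:R - \sum_(n < N.+1) n%:R * p n).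
Proof.
elim: N => [|N ih]; first by rewrite !big_ord_recr/= !big_ord0; ring.
rewrite big_ord_recr/= ih !(big_ord_recr N.+1)/= !(big_ord_recr N)/=.
by rewrite -!natr1; ring.
Qed.

(* Weighted AM-GM turns the mean of the flux into the defect; the constant
   1/4 is the price of the weight. *)
Lemma rbar_near_rstar (R : realType) mu (A q : R) p N :
  0 < q -> q < 1 -> 0 < A -> controlled mu A q p ->
  `|(mu%:R + 1) * rbar p - mu%:R| <=
    4 * A / (1 - q) * (defect p N + q ^+ N) + 4^-1.
Proof.
move=> q0 q1 A0 cp; have /andP[r0 r1] := controlled_rbar cp.
have fl := sum_mean_flux mu p N.
case: cp => p0 pA _ t0 t1.
have d0 : 0 < 1 - q by lra.
(* Chosen so that eta times the weighted sum, which is at most 2 A / (1 - q), is at most 1/4. *)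
set eta := (1 - q) / (8 * A).
have eta0 : 0 < eta by rewrite divr_gt0// mulr_gt0.
have qN0 : 0 <= q ^+ N by rewrite exprn_ge0// ltW.
have B : `|\sum_(n < N) n.+1%:R * (rbar p * p n - p n.+1)| <=
    (2 * eta)^-1 * defect p N + 4^-1.
  apply: le_trans (ler_norm_sum _ _ _) _.
  apply: le_trans (_ : \sum_(n < N) ((2 * eta)^-1 *
      (Num.sqrt (rbar p * p n) - Num.sqrt (p n.+1)) ^+ 2 +
      eta * (n.+1%:R ^+ 2 * (p n + p n.+1))) <= _).
    apply: ler_sum => n _.
    have an : 0 <= rbar p * p n by apply: mulr_ge0.
    set x := Num.sqrt (rbar p * p n); set y := Num.sqrt (p n.+1).
    have xa : rbar p * p n = x ^+ 2 by rewrite sqr_sqrtr.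
    have yb : p n.+1 = y ^+ 2 by rewrite sqr_sqrtr.
    have xp : x ^+ 2 <= p n by rewrite -xa ler_piMl.
    have x0 : 0 <= x by exact: sqrtr_ge0.
    have y0 : 0 <= y by exact: sqrtr_ge0.
    rewrite xa yb normrM ger0_norm// subr_sqr normrM (ger0_norm (addr_ge0 x0 y0)).
    set m := n.+1%:R; have m0 : 0 <= m :> R by [].
    set z := `|x - y|; rewrite -(real_normK (num_real (x - y))) -/z.
    (* AM-GM for z and m (x + y); then (x + y)^2 <= 2 (x^2 + y^2), with x^2 = r p_n <= p_n. *)
    apply: le_trans (_ : (2 * eta)^-1 * z ^+ 2 + eta / 2 * (m * (x + y)) ^+ 2 <= _).
      have : 0 <= (2 * eta)^-1 * (z - eta * (m * (x + y))) ^+ 2.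
        by rewrite mulr_ge0 ?sqr_ge0// invr_ge0 mulr_ge0// ltW.
      suff -> : (2 * eta)^-1 * (z - eta * (m * (x + y))) ^+ 2 =
        (2 * eta)^-1 * z ^+ 2 + eta / 2 * (m * (x + y)) ^+ 2
        - m * (z * (x + y)) by lra.
      by field; rewrite gt_eqF.
    rewrite lerD2l -mulrA ler_pM2l// exprMn mulrCA ler_wpM2l ?sqr_ge0//.
    have : 0 <= (x - y) ^+ 2 by exact: sqr_ge0.
    by nra.
  rewrite big_split/= -!mulr_sumr lerD2l.
  have : \sum_(n < N) (n.+1%:R ^+ 2 * (p n + p n.+1)) <= 2 * A / (1 - q).
    apply: (@sum_geometric_le R (fun n => n.+1%:R ^+ 2 * (p n + p n.+1))) => //.
      by rewrite mulr_ge0// ltW.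
    move=> n; have h1 := pA n; have h2 := pA n.+1.
    have h3 : n.+1%:R ^+ 2 * p n.+1 <= n.+2%:R ^+ 2 * p n.+1.
      by rewrite ler_wpM2r// lerXn2r ?nnegrE// ler_nat.
    have h4 : A * q ^+ n.+1 <= A * q ^+ n.
      rewrite ler_pM2l// exprS ler_piMl ?exprn_ge0//; exact: ltW.
    by rewrite mulrDr; lra.
  move=> h; apply: le_trans (_ : eta * (2 * A / (1 - q)) <= _).
    by rewrite ler_pM2l.
  by apply: eqW_ler; rewrite /eta; field; rewrite !gt_eqF.
have e1 : (2 * eta)^-1 = 4 * A / (1 - q).
  by rewrite /eta; field; rewrite !gt_eqF.
rewrite e1 in B.
have t0N := t0 N; have t1N := t1 N; have t1S := t1 N.+1.
have qS : A * q ^+ N.+1 <= A * q ^+ N.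
  rewrite ler_pM2l// exprS ler_piMl//; exact: ltW.
have gA : 2 * A * q ^+ N <= 4 * A / (1 - q) * q ^+ N.
  rewrite ler_wpM2r// ler_pdivlMr//; nra.
rewrite fl in B; rewrite [_ * (defect _ _ + _)]mulrDr.
set X := 4 * A / (1 - q) * defect p N in B *.
set Y := 4 * A / (1 - q) * q ^+ N in gA *.
set u := mu%:R - _ in B t1N; set v := 1 - _ in B t0N.
set w := mu%:R - _ in B t1S.
have h : 0 <= rbar p * (u + v) <= u + v.
  have uv : 0 <= u + v by lra.
  by rewrite mulr_ge0//= ler_piMl.
move: B; set m := (_ * rbar p - _); set z := rbar p * (u + v) in h *.
by rewrite !ler_norml; lra.
Qed.

(** * The entropy bounded by the defect *)

(** Inserting the geometric law g of ratio r splits the entropy into three sums: the entropy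
    relative to g, made quadratic by the correction - p + g ([I3]), a difference of masses ([I2]),
    and a part affine in n ([I1]). The last two leave only tails. *)
Lemma partial_entropy_geometric_le (R : realType) mu (A q c : R) p N :
  (0 < mu)%N -> 0 < c -> c <= pstar0 R mu -> c <= rstar R mu -> 1 - c <= q ->
  q < 1 -> 0 < A -> controlled mu A q p -> c <= rbar p <= 1 - c ->
  partial_entropy mu p N.+1 <=
    (5 - 4 * ln c) * 4 / c ^+ 2 * (N.+1%:R * defect p N) +
    (1 - 2 * ln c * A) * q ^+ N.
Proof.
move=> mu0 c0 cs cr cq q1 A0 cp /andP[rc rc1].
have p1 := controlled_le1 cp; case: cp => p0 pA pl t0 t1.
set r := rbar p in rc rc1 *.
have q0 : 0 < q by lra.
have qN n : 0 <= q ^+ n by rewrite exprn_ge0// ltW.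
have r0 : 0 < r by lra.
have r1 : 0 < 1 - r by lra.
have S0 := pstar0_gt0 R mu; have R0 := rstar_gt0 R mu0.
have s1 : pstar0 R mu = 1 - rstar R mu by rewrite /rstar; ring.
have m1 : (1 : R) <= mu%:R by rewrite ler1n.
have lc : ln c <= 0 by apply: ln_le0; lra.
have lcb x : c <= x -> x <= 1 -> ln c <= ln x <= 0.
  by move=> cx x1; rewrite ln_le0// ler_ln ?posrE ?cx// (lt_le_trans c0 cx).
pose g n := (1 - r) * r ^+ n.
have g0 n : 0 < g n by rewrite mulr_gt0// exprn_gt0.
pose al := ln (1 - r) - ln (pstar0 R mu).
pose be := ln r - ln (rstar R mu).
have al1 : al <= - ln c.
  have : ln c <= ln (pstar0 R mu) <= 0 by apply: lcb => //; lra.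
  have : ln (1 - r) <= 0 by apply: ln_le0; lra.
  by rewrite /al; lra.
have al2 : ln c <= al.
  have : ln (pstar0 R mu) <= 0 by apply: ln_le0; lra.
  have : ln c <= ln (1 - r) <= 0 by apply: lcb; lra.
  by rewrite /al; lra.
have be1 : be <= - ln c.
  have : ln c <= ln (rstar R mu) <= 0 by apply: lcb => //; lra.
  have : ln r <= 0 by apply: ln_le0; lra.
  by rewrite /be; lra.
have be2 : ln c <= be.
  have : ln (rstar R mu) <= 0 by apply: ln_le0; lra.
  have : ln c <= ln r <= 0 by apply: lcb; lra.
  by rewrite /be; lra.
(* Among geometric laws, the entropy relative to [pstar] of a law of mean
   [mu] is smallest. *)
have gibbs : al + mu%:R * be <= 0.
  (* The bound ln x <= x - 1 is used twice, with weights 1 and mu; the two right sides cancel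
     exactly. *)
  have h1 : al <= (1 - r) / pstar0 R mu - 1.
    by rewrite /al -ln_div ?posrE//; apply: ler_lnB1; rewrite divr_gt0.
  have h2 : be <= r / rstar R mu - 1.
    by rewrite /be -ln_div ?posrE//; apply: ler_lnB1; rewrite divr_gt0.
  have e1 : (1 - r) / pstar0 R mu - 1 = (1 - r) * (1 + mu%:R) - 1.
    by rewrite /pstar0; field; lra.
  have e2 : mu%:R * (r / rstar R mu - 1) = r * (1 + mu%:R) - mu%:R.
    rewrite /rstar /pstar0; field.
    by apply/andP; split; lra.
  have h3 : mu%:R * be <= mu%:R * (r / rstar R mu - 1) by rewrite ler_wpM2l//; lra.
  by lra.
have split n : p n * ln (p n / pstar R mu n) =
   (p n * ln (p n / g n) - p n + g n) + (p n - g n) + (p n * al + (n%:R * p n) * be).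
  have [pz|pn] := eqVneq (p n) 0; first by rewrite pz; ring.
  have pp : 0 < p n by rewrite lt_def pn p0.
  have lg : ln (g n) = ln (1 - r) + n%:R * ln r.
    by rewrite lnM ?posrE ?exprn_gt0// lnXn// mulr_natl.
  by rewrite !ln_div ?posrE ?pstar_gt0// ln_pstar// lg /al /be; ring.
rewrite /partial_entropy; under eq_bigr do rewrite split.
rewrite !big_split/= -!mulr_suml.
(* Over all n this would be al + mu be <= 0; truncation adds two tails, with |al| and |be| at most -
   ln c. *)
have I1 : \sum_(i < N.+1) p i * al + \sum_(i < N.+1) (i%:R * p i) * be <=
    - 2 * ln c * A * q ^+ N.
  have t0N := t0 N.+1; have t1N := t1 N.+1.
  have qS : A * q ^+ N.+1 <= A * q ^+ N.
    by rewrite ler_pM2l// exprS ler_piMl//; exact: ltW.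
  rewrite -!mulr_suml.
  set s0 := \sum_(i < N.+1) p i in t0N *.
  set s3 := \sum_(i < N.+1) _ in t1N *.
  have h1 : (1 - s0) * - al <= A * q ^+ N * - ln c by nra.
  have h2 : (mu%:R - s3) * - be <= A * q ^+ N * - ln c by nra.
  by lra.
have I2 : \sum_(i < N.+1) p i - \sum_(i < N.+1) g i <= q ^+ N.
  have t0N := t0 N.+1.
  have -> : \sum_(i < N.+1) g i = 1 - r ^+ N.+1.
    by have := subrX1 r N.+1; rewrite -mulr_sumr; lra.
  have : r ^+ N.+1 <= q ^+ N.
    apply: le_trans (_ : r ^+ N <= _).
      by rewrite exprS ler_piMl ?exprn_ge0 ?ltW//; lra.
    by apply: lerXn2r; rewrite ?nnegrE ?(le_trans rc1 cq)// ltW.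
  by lra.
pose w n := Num.sqrt (p n) - Num.sqrt (g n).
pose sg := Num.sqrt r.
have sg0 : 0 <= sg by exact: sqrtr_ge0.
have sgr : sg ^+ 2 = r by rewrite sqr_sqrtr// ltW.
(* From (1 - sg) (1 + sg) = 1 - r >= c and 1 + sg <= 2. *)
have sg1 : c / 2 <= 1 - sg by nra.
have hardy : c ^+ 2 / 4 * \sum_(i < N.+1) w i ^+ 2 <= defect p N.
  apply: le_trans (_ : (1 - sg) ^+ 2 * \sum_(i < N.+1) w i ^+ 2 <= _).
    apply: ler_wpM2r; first by apply: sumr_ge0 => i _; exact: sqr_ge0.
    have : 0 <= c / 2 by lra.
    by nra.
  have -> : defect p N = \sum_(i < N) (Num.sqrt (p i.+1) - Num.sqrt (r * p i)) ^+ 2.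
    by apply: eq_bigr => i _; rewrite -sqrrN opprB.
  apply: (@sum_sqr_affine_rec R w
    (fun n => Num.sqrt (p n.+1) - Num.sqrt (r * p n))) => //; first by nra.
    by rewrite /w /g expr0 mulr1 /r /rbar opprB addrCA subrr addr0 subrr.
  move=> n; rewrite /w /g exprS mulrCA !sqrtrM ?ltW// /sg; ring.
have I3 : \sum_(i < N.+1) (p i * ln (p i / g i) - p i + g i) <=
    (5 - 4 * ln c) * N.+1%:R * \sum_(i < N.+1) w i ^+ 2.
  rewrite mulr_sumr; apply: ler_sum => n _.
  have L0 : 0 <= n.+1%:R * - ln c by rewrite mulr_ge0//; lra.
  (* Since p_n <= 1 and g_n >= c^(n+1), the log-ratio bound is L = - (n + 1) ln c: this is where the
     factor N + 1 arises. *)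
  apply: le_trans (kl_le_hellinger (p0 n) (g0 n) L0 _) _.
    apply: le_trans (p1 n) _.
    rewrite mulrN expRN -ler_pdivrMr ?invr_gt0 ?expR_gt0// invrK mul1r.
    rewrite expRM_natl lnK ?posrE// exprS.
    have c1r : c <= 1 - r by lra.
    apply: ler_pM; [exact: ltW|by rewrite exprn_ge0// ltW|by []|].
    by apply: lerXn2r; rewrite ?nnegrE// ltW.
  apply: ler_wpM2r; first exact: sqr_ge0.
  have n1 : (1 : R) <= N.+1%:R by rewrite ler1n.
  have nN : n.+1%:R <= N.+1%:R :> R by rewrite ler_nat ltn_ord.
  have : n.+1%:R * - ln c <= N.+1%:R * - ln c by rewrite ler_wpM2r//; lra.
  by lra.
have c2 : 0 < c ^+ 2 by rewrite exprn_gt0.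
have W : \sum_(i < N.+1) w i ^+ 2 <= 4 / c ^+ 2 * defect p N.
  rewrite -ler_pdivrMl ?divr_gt0// invf_div.
  exact: hardy.
have I4 : (5 - 4 * ln c) * N.+1%:R * \sum_(i < N.+1) w i ^+ 2 <=
   (5 - 4 * ln c) * N.+1%:R * (4 / c ^+ 2 * defect p N).
  by apply: ler_wpM2l W; apply: mulr_ge0 => //; lra.
have -> : (5 - 4 * ln c) * 4 / c ^+ 2 * (N.+1%:R * defect p N) =
   (5 - 4 * ln c) * N.+1%:R * (4 / c ^+ 2 * defect p N) by ring.
move: I1 I2 I3 I4; rewrite !big_split/= -?mulr_suml !sumrN.
lra.
Qed.

(** If B (E_N + q^N) <= 1/4, then |(mu + 1) r - mu| <= 1/2, so r lies in [c, 1 - c] and the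
    comparison with a geometric law applies. Otherwise 1 < 4 B (E_N + q^N), and the uniform bound
    [H] is enough. *)
Lemma entropy_le_defect (R : realType) mu (A q : R) :
  (0 < mu)%N -> 0 < A -> 1 - (2 * (mu%:R + 1))^-1 <= q -> q < 1 ->
  exists2 C : R, 0 < C & forall p N, controlled mu A q p ->
    partial_entropy mu p N.+1 <= C * (N.+1%:R * defect p N + q ^+ N).
Proof.
move=> mu0 A0; set c := _^-1 => cq q1.
have m1 : (1 : R) <= mu%:R by rewrite ler1n.
have c0 : 0 < c by rewrite invr_gt0; lra.
have cm : c * (mu%:R + 1) = 2^-1 by rewrite /c; field; lra.
have c1 : c <= 4^-1 by nra.
have lc : ln c <= 0 by apply: ln_le0; lra.
have d0 : 0 < 1 - q by lra.
have q0 : 0 < q by lra.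
have cs : c <= pstar0 R mu.
  have : pstar0 R mu * (mu%:R + 1) = 1 by rewrite /pstar0; field; lra.
  by nra.
have cr : c <= rstar R mu.
  have : rstar R mu * (mu%:R + 1) = mu%:R by rewrite /rstar /pstar0; field; lra.
  by nra.
set B := 4 * A / (1 - q); set H := (1 + ln (1 + mu%:R)) * A / (1 - q).
set C1 := (5 - 4 * ln c) * 4 / c ^+ 2; set C2 := 1 - 2 * ln c * A.
have B0 : 0 < B by rewrite divr_gt0// mulr_gt0.
have H0 : 0 <= H.
  have l0 : 0 <= ln (1 + mu%:R : R) by rewrite ln_ge0// lerDl.
  by apply: divr_ge0; [apply: mulr_ge0; [lra|exact: ltW]|exact: ltW].
have C10 : 0 < C1 by rewrite !divr_gt0 ?mulr_gt0 ?exprn_gt0//; lra.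
have C20 : 0 < C2 by rewrite /C2; nra.
have BH : 0 <= B * H by rewrite mulr_ge0// ltW.
exists (C1 + C2 + 4 * (B * H)); first lra.
move=> p N cp.
have D0 := defect_ge0 p N; have qN : 0 <= q ^+ N by rewrite exprn_ge0// ltW.
have N1 : (1 : R) <= N.+1%:R by rewrite ler1n.
have DN : defect p N <= N.+1%:R * defect p N by rewrite ler_peMl.
set X := N.+1%:R * defect p N in DN *.
have [small|big] := leP (B * (defect p N + q ^+ N)) 4^-1.
  have nr := rbar_near_rstar N q0 q1 A0 cp; rewrite -/B in nr.
  have {}nr : `|(mu%:R + 1) * rbar p - mu%:R| <= 2^-1 by lra.
  have rc : c <= rbar p <= 1 - c.
    by move: nr; rewrite ler_norml; clear -cm m1 c0; nra.
  apply: le_trans (partial_entropy_geometric_le N mu0 c0 cs cr cq q1 A0 cp rc) _.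
  rewrite -/X -/C1 -/C2.
  have : 0 <= (C2 + 4 * (B * H)) * X by rewrite mulr_ge0//; lra.
  have : 0 <= (C1 + 4 * (B * H)) * q ^+ N by rewrite mulr_ge0//; lra.
  by lra.
apply: le_trans (partial_entropy_le N.+1 mu0 q0 q1 (ltW A0) cp) _.
rewrite -/H.
have h1 : H <= 4 * (H * (B * (defect p N + q ^+ N))).
  have : 0 <= H * (B * (defect p N + q ^+ N) - 4^-1) by rewrite mulr_ge0//; lra.
  by lra.
have h2 : B * H * defect p N <= B * H * X by rewrite ler_wpM2l.
have : 0 <= (C1 + C2) * (X + q ^+ N) by rewrite mulr_ge0//; lra.
by lra.
Qed.

Lemma exprn_le_small (R : realType) (A q e : R) :
  0 < q -> q < 1 -> 0 < A -> 0 < e -> exists m, A * q ^+ m <= e.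
Proof.
move=> q0 q1 A0 e0.
have q1' : `|q| < 1 by rewrite ger0_norm// ltW.
have /cvgrPdist_le/(_ e e0) [m _ h] := @cvg_geometric R A q q1'.
exists m; have := h m (leqnn m).
by rewrite /= sub0r normrN ger0_norm// mulr_ge0 ?exprn_ge0// ltW.
Qed.

(** The tails beyond some m carry at most 1/2 of the mean, so at least mu - 1/2 >= 1/2 comes from 1
    <= n <= m, where the mass is at most r. *)
Lemma rbar_lower_bound (R : realType) mu (A q : R) :
  (0 < mu)%N -> 0 < q -> q < 1 -> 0 < A ->
  exists2 c : R, 0 < c & forall p, controlled mu A q p -> c <= rbar p.
Proof.
move=> mu0 q0 q1 A0.
have m1 : (1 : R) <= mu%:R by rewrite ler1n.
have e2 : 0 < 2^-1 :> R by [].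
have [m mA] := exprn_le_small q0 q1 A0 e2.
exists (2 * m.+1%:R)^-1; first by rewrite invr_gt0 mulr_gt0.
move=> p cp; have /andP[r0 _] := controlled_rbar cp.
case: cp => p0 _ _ /(_ m.+1) s0 /(_ m.+1) s1.
have qS : A * q ^+ m.+1 <= A * q ^+ m.
  by rewrite ler_pM2l// exprS ler_piMl ?exprn_ge0//; exact: ltW.
have : \sum_(n < m.+1) n%:R * p n <= m.+1%:R * rbar p.
  apply: le_trans (_ : m.+1%:R * (\sum_(n < m.+1) p n - p 0%N) <= _).
    rewrite !big_ord_recl/= mul0r add0r addrAC subrr add0r mulr_sumr.
    apply: ler_sum => i _; rewrite ler_wpM2r// ler_nat /bump/=.
    by rewrite add1n ltnS ltnW.
  by rewrite ler_wpM2l// /rbar; lra.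
move=> h; rewrite -[leLHS]mul1r ler_pdivrMr ?mulr_gt0//; lra.
Qed.

(** * Decay of the truncated entropy along solutions *)

(** A component vanishing at t > 0 is at an interior minimum, so its derivative is 0; as r > 0, the
    system makes its neighbours vanish too. All components would then be 0, against total mass 1.
    Positivity is what allows [ln] to be differentiated. *)
Lemma solution_gt0 (R : realType) mu (A q : R) (p : R -> nat -> R) :
  (0 < mu)%N -> 0 < q -> q < 1 -> 0 < A -> mean_field_solution p ->
  (forall t : R, 0 < t -> controlled mu A q (p t)) ->
  forall t : R, 0 < t -> forall n, 0 < p t n.
Proof.
move=> mu0 q0 q1 A0 [_ sol] cp t t0.
have [c c0 rc] := rbar_lower_bound mu0 q0 q1 A0.
have r0 : 0 < rbar (p t) by apply: lt_le_trans c0 (rc _ (cp _ t0)).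
have p0 n (s : R) : 0 < s -> 0 <= p s n by move=> s0; case: (cp s s0).
have der0 n (d : R -> R) : p t n = 0 ->
    (forall s : R, 0 < s -> is_derive s 1 (fun s : R => p s n) (d s)) -> d t = 0.
  move=> pz dp.
  have h : is_derive t 1 (fun s : R => p s n) 0.
    apply: (@derive1_at_min R _ 0 (2 * t)); first by rewrite mulr_ge0// ltW.
    - by move=> s; rewrite in_itv/= => /andP[s0 _]; case: (dp s s0).
    - by rewrite in_itv/= t0/=; lra.
    - by move=> s; rewrite in_itv/= => /andP[s0 _]; rewrite pz p0.
  by case: (dp t t0) => _ <-; case: h => _ ->.
have up n : p t n = 0 -> p t n.+1 = 0 /\ p t n.-1 = 0.
  case: n => [|n] pz.
    split=> //; have := der0 0%N _ pz (fun s s0 => (sol s s0).1).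
    by rewrite pz mulr0 subr0.
  have := der0 n.+1 _ pz (fun s s0 => (sol s s0).2 n).
  have h1 := p0 n.+2 t t0; have h2 := p0 n t t0.
  rewrite pz mulr0 subr0 /= => e.
  have h3 : 0 <= rbar (p t) * p t n by rewrite mulr_ge0// ltW.
  have e1 : p t n.+2 = 0 by lra.
  have /eqP : rbar (p t) * p t n = 0 by lra.
  by rewrite mulf_eq0 gt_eqF//= => /eqP.
move=> n; rewrite lt_def p0// andbT; apply/eqP => pz.
(* Subtraction stops at 0, which matches the convention [0.-1 = 0] in [up]. *)
have down k : p t (n - k)%N = 0.
  by elim: k => [|k ih]; rewrite ?subn0// subnS; case: (up _ ih).
have all0 k : p t k = 0.
  by elim: k => [|k ih]; [rewrite -(subnn n) down|case: (up _ ih)].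
have e2 : 0 < 2^-1 :> R by [].
have [m mA] := exprn_le_small q0 q1 A0 e2.
case: (cp t t0) => _ _ _ /(_ m) + _.
by rewrite big1 => [|i _]; [lra|rewrite all0].
Qed.

Lemma is_derive_mul_ln (R : realType) (c x : R) : 0 < c -> 0 < x ->
  is_derive x 1 (fun y : R => y * ln (y / c)) (ln (x / c) + 1).
Proof.
move=> c0 x0.
have h0 : is_derive x 1 (fun y : R => y * (ln y - ln c)) (ln (x / c) + 1).
  have h1 := is_derive1_ln x0.
  have h2 : is_derive x 1 (fun y : R => ln y - ln c) x^-1.
    by apply: is_derive_eq; rewrite subr0.
  apply: is_derive_eq.
  rewrite ln_div ?posrE// /GRing.scale/=. by rewrite mulfV ?gt_eqF// mulr1 addrC.
(* Splitting the logarithm of the quotient requires y > 0, which holds near x. *)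
apply: near_eq_is_derive h0.
near=> y; rewrite ln_div ?posrE//; near: y.
exact: lt_nbhsr.
Unshelve. all: by end_near. Qed.

(** The net flow from n to n + 1. The system becomes the conservation law p_n' = J_{n-1} - J_n, with
    p_0' = - J_0. *)
Definition flux (R : realType) (p : nat -> R) (n : nat) : R :=
  rbar p * p n - p n.+1.

(** The derivative of the n-th entropy term with respect to p_n. *)
Definition potential (R : realType) mu (p : nat -> R) (n : nat) : R :=
  ln (p n / pstar R mu n) + 1.

Lemma is_derive_partial_entropy (R : realType) mu (p : R -> nat -> R) (t : R) N :
  (0 < mu)%N -> mean_field_solution p -> 0 < t -> (forall n, 0 < p t n) ->
  is_derive t 1 (fun s : R => partial_entropy mu (p s) N.+1)
    (\sum_(n < N) flux (p t) n *
        (potential mu (p t) n.+1 - potential mu (p t) n)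
      - flux (p t) N * potential mu (p t) N).
Proof.
move=> mu0 [_ sol] t0 pt; set x := potential mu (p t); have [d0 dS] := sol t t0.
have -> : (fun s : R => partial_entropy mu (p s) N.+1) =
    \sum_(n < N.+1) (fun s : R => p s n * ln (p s n / pstar R mu n)).
  by apply/funext => s; rewrite fct_sumE.
have term n d : is_derive t 1 (fun s : R => p s n) d ->
    is_derive t 1 (fun s : R => p s n * ln (p s n / pstar R mu n)) (x n * d).
  move=> dn.
  exact: (is_derive1_comp (is_derive_mul_ln (pstar_gt0 R n mu0) (pt n)) dn).
pose dp n := if n is n'.+1 then flux (p t) n' - flux (p t) n else - flux (p t) 0.
have hp n : is_derive t 1 (fun s : R => p s n) (dp n).
  case: n => [|n] /=.
    by apply: is_derive_eq; rewrite /flux; ring.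
  have := dS n => ?; apply: is_derive_eq; rewrite /flux; ring.
have hs := @is_derive_sum _ _ _ N.+1 _ _ _ _ (fun i : 'I_N.+1 => term i _ (hp i)).
apply: is_derive_eq hs _.
rewrite -sum_flux_by_parts big_ord_recl/= mulrC; congr (_ + _).
by apply: eq_bigr => i _; rewrite mulrC.
Qed.

(* The boundary term is harmless although [ln (p N)] is unbounded below: it
   comes with the factor [p N.+1 >= 0], so it has the favorable sign. *)
Lemma entropy_production_le (R : realType) mu (A q c : R) p N :
  (0 < mu)%N -> 0 < q -> q < 1 -> 0 < A -> 0 < c ->
  controlled mu A q p -> c <= rbar p -> (forall n, 0 < p n) ->
  \sum_(n < N) flux p n * (potential mu p n.+1 - potential mu p n)
    - flux p N * potential mu p N <=
  - 2 * defect p N +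
  (2 + ln (1 + mu%:R) - ln c - ln (rstar R mu)) * A * q ^+ N.
Proof.
move=> mu0 q0 q1 A0 c0 cp cr pp; set x := potential mu p.
have p1 := controlled_le1 cp; have /andP[r0 r1] := controlled_rbar cp.
have rp : 0 < rbar p by exact: lt_le_trans cr.
have S0 := rstar_gt0 R mu0.
have S1 : rstar R mu <= 1 by have := pstar0_gt0 R mu; rewrite /rstar; lra.
have lS : ln (rstar R mu) <= 0 by exact: ln_le0.
have lr : ln (rbar p) <= 0 by exact: ln_le0.
have lcr : ln c <= ln (rbar p) by rewrite ler_ln ?posrE.
case: cp => p0 pA pl t0 t1.
pose be := ln (rbar p) - ln (rstar R mu).
have xE n : x n = ln (p n) + 1 - ln (pstar R mu n).
  by rewrite /x /potential ln_div ?posrE ?pstar_gt0//; ring.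
(* The increment of [x] is ln p_{n+1} - ln (r p_n) + be: a dissipation term, plus a constant because
   ln pstar is affine in n. *)
have step n : flux p n * (x n.+1 - x n) <=
   - 2 * (Num.sqrt (rbar p * p n) - Num.sqrt (p n.+1)) ^+ 2 + flux p n * be.
  have := hellinger_le_dissipation (mulr_gt0 rp (pp n)) (pp n.+1).
  rewrite lnM ?posrE// !xE !ln_pstar// -(natr1 n) /flux /be; lra.
(* The total flux reduces to tails of the mass, so the constant [be] costs only a multiple of
   q^N. *)
have SJ : \sum_(n < N) flux p n = (1 - \sum_(n < N.+1) p n) -
    rbar p * (1 - \sum_(n < N) p n).
  rewrite /flux sumrB -mulr_sumr big_ord_recl/= /rbar.
  have -> : \sum_(i < N) p (bump 0 i) = \sum_(i < N) p i.+1 by [].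
  ring.
have qS : A * q ^+ N.+1 <= A * q ^+ N.
  by rewrite ler_pM2l// exprS ler_piMl ?exprn_ge0//; exact: ltW.
have SJb : (\sum_(n < N) flux p n) * be <= A * q ^+ N * (- ln c - ln (rstar R mu)).
  have t0N := t0 N; have t0S := t0 N.+1; rewrite SJ.
  set v := 1 - _ in t0S *; set u := 1 - _ in t0N *.
  have : `|(v - rbar p * u) * be| <= A * q ^+ N * (- ln c - ln (rstar R mu)).
    rewrite normrM; apply: ler_pM => //.
      have ru : 0 <= rbar p * u <= u.
        have /andP[u0 _] := t0N; by rewrite mulr_ge0//= ler_piMl.
      by rewrite ler_norml; lra.
    by rewrite ler_norml /be; lra.
  exact: le_trans (ler_norm _).
have bd : - (flux p N * x N) <= (2 + ln (1 + mu%:R)) * A * q ^+ N.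
  rewrite xE /flux.
  have := Nln_pstar_bounds R N mu0.
  set k := ln (1 + _); set s := - ln (pstar R mu N) => /andP[s0 s1].
  have k0 : 0 <= k by apply: ln_ge0; rewrite lerDl.
  have h1 : rbar p * - (p N * ln (p N)) <= A * q ^+ N.
    apply: le_trans (pl N); rewrite ler_piMl// oppr_ge0 mulr_ge0_le0//.
    exact: ln_le0.
  have h2 : p N.+1 * ln (p N) <= 0 by rewrite mulr_ge0_le0//; exact: ln_le0.
  have h3 : 0 <= rbar p * p N * (1 + s).
    by apply: mulr_ge0; [exact: mulr_ge0|lra].
  (* The linear growth of [s] is absorbed by the weight (N + 2)^2 that [controlled] puts on
     [p N.+1]. *)
  have h4 : p N.+1 * (1 + s) <= (1 + k) * (A * q ^+ N).
    apply: le_trans (_ : p N.+1 * ((1 + k) * N.+2%:R ^+ 2) <= _).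
      rewrite ler_wpM2l//.
      have n1 : (1 : R) <= N.+1%:R by rewrite ler1n.
      have n2 : N.+1%:R <= N.+2%:R ^+ 2 :> R.
        by rewrite -(natr1 N.+1); nra.
      have : k * N.+1%:R <= k * N.+2%:R ^+ 2 by rewrite ler_wpM2l.
      by lra.
    rewrite mulrCA ler_wpM2l//; first lra.
    by apply: le_trans qS; rewrite mulrC; exact: pA.
  have -> : - ((rbar p * p N - p N.+1) * (ln (p N) + 1 - ln (pstar R mu N))) =
    rbar p * - (p N * ln (p N)) + p N.+1 * ln (p N) - rbar p * p N * (1 + s)
    + p N.+1 * (1 + s) by rewrite /s; ring.
  by lra.
have : \sum_(n < N) flux p n * (x n.+1 - x n) <=
    - 2 * defect p N + (\sum_(n < N) flux p n) * be.
  rewrite /defect mulr_sumr mulr_suml -big_split/=.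
  by apply: ler_sum => n _; exact: step.
by lra.
Qed.

(** * Integration in time and choice of the cutoff *)

Lemma linear_differential_ineq (R : realType) (y dy : R -> R) (lam b : R) :
  (forall u : R, 0 < u -> is_derive u 1 y (dy u)) ->
  (forall u : R, 0 < u -> dy u <= - lam * (y u - b)) ->
  forall s t : R, 0 < s -> s <= t ->
    y t - b <= expR (- (lam * (t - s))) * (y s - b).
Proof.
move=> yd ydle s t s0 st.
(* The integrating factor makes [z] nonincreasing. *)
pose z (u : R) := expR (lam * u) * (y u - b).
have zd (u : R) : 0 < u ->
    is_derive u 1 z (expR (lam * u) * (dy u + lam * (y u - b))).
  move=> u0; have h := yd u u0.
  have h1 : is_derive u 1 (fun v : R => lam * v) lam.
    by apply: is_derive_eq; rewrite /GRing.scale/= mulr1.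
  have h2 : is_derive u 1 (fun v : R => expR (lam * v)) (expR (lam * u) * lam).
    exact: (is_derive1_comp (is_derive_expR _) h1).
  have h3 : is_derive u 1 (fun v : R => y v - b) (dy u).
    by apply: is_derive_eq; rewrite subr0.
  apply: is_derive_eq; rewrite /GRing.scale/=; ring.
have zt : z t <= z s.
  apply: (@ler0_derive1_le_cc R z s t) => //; rewrite ?in_itv/= ?lexx ?st//.
  - move=> u; rewrite in_itv/= => /andP[su _].
    by case: (zd u (lt_trans s0 su)).
  - move=> u; rewrite in_itv/= => /andP[su _].
    rewrite derive1E; case: (zd u (lt_trans s0 su)) => _ ->.
    rewrite mulr_ge0_le0 ?expR_ge0//.
    have := ydle u (lt_trans s0 su); lra.
  - apply: continuous_in_subspaceT => u; rewrite inE/= in_itv/= => /andP[su _].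
    apply: differentiable_continuous; apply/derivable1_diffP.
    by case: (zd u (lt_le_trans s0 su)).
have -> : expR (- (lam * (t - s))) = expR (lam * s) / expR (lam * t).
  by rewrite -expRN -expRD; congr expR; ring.
by rewrite mulrAC ler_pdivlMr ?expR_gt0// mulrC.
Qed.

Lemma partial_entropy_decay (R : realType) mu (A q : R) (p : R -> nat -> R) :
  (0 < mu)%N -> 0 < A -> 1 - (2 * (mu%:R + 1))^-1 <= q -> q < 1 ->
  mean_field_solution p -> (forall t : R, 0 < t -> controlled mu A q (p t)) ->
  exists C lam : R, [/\ 0 < C, 0 < lam & forall (t : R) N, 0 < t ->
    partial_entropy mu (p t) N.+1 <=
      C * (N.+1%:R * q ^+ N + expR (- (lam * (t / N.+1%:R))))].
Proof.
move=> mu0 A0 cq q1 sol cp.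
have m1 : (1 : R) <= mu%:R by rewrite ler1n.
have q0 : 0 < q.
  apply: lt_le_trans cq; rewrite subr_gt0 invf_lt1; lra.
have [C C0 CP] := entropy_le_defect mu0 A0 cq q1.
have [c c0 rc] := rbar_lower_bound mu0 q0 q1 A0.
have pt := solution_gt0 mu0 q0 q1 A0 sol cp.
pose K := `|(2 + ln (1 + mu%:R) - ln c - ln (rstar R mu)) * A|.
pose H := `|(1 + ln (1 + mu%:R)) * A / (1 - q)|.
have K0 : 0 <= K by exact: normr_ge0.
have H0 : 0 <= H by exact: normr_ge0.
have CK0 : 0 <= C * K by rewrite mulr_ge0// ltW.
exists (C + C * K + H); exists C^-1; split; [lra|by rewrite invr_gt0|].
move=> t N t0.
have N1 : (1 : R) <= N.+1%:R by rewrite ler1n.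
have qN : 0 <= q ^+ N by rewrite exprn_ge0// ltW.
(* With this rate, [CP] reads lam H_N <= 2 E_N + lam C q^N. *)
pose lam := 2 / (C * N.+1%:R).
have lam0 : 0 < lam by rewrite divr_gt0// mulr_gt0.
(* The level at which damping balances the source terms: lam b = (lam C + K) q^N. *)
pose b := (C + C * K / 2 * N.+1%:R) * q ^+ N.
have b0 : 0 <= b.
  have : 0 <= C * K / 2 * N.+1%:R by apply: mulr_ge0 => //; lra.
  by move=> h; apply: mulr_ge0 => //; lra.
have bN : b <= (C + C * K) * (N.+1%:R * q ^+ N).
  rewrite mulrA ler_wpM2r// mulrDl; apply: lerD; first by rewrite ler_peMr// ltW.
  by rewrite ler_wpM2r//; lra.
have ineq (u : R) : 0 < u ->
  \sum_(n < N) flux (p u) n * (potential mu (p u) n.+1 - potential mu (p u) n)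
    - flux (p u) N * potential mu (p u) N <=
  - lam * (partial_entropy mu (p u) N.+1 - b).
  move=> u0.
  apply: le_trans (entropy_production_le N mu0 q0 q1 A0 c0 (cp u u0)
    (rc _ (cp u u0)) (pt u u0)) _.
  have h1 := CP _ N (cp u u0).
  have h2 : (2 + ln (1 + mu%:R) - ln c - ln (rstar R mu)) * A * q ^+ N <= K * q ^+ N.
    by rewrite ler_wpM2r// ler_norm.
  have h3 : lam * partial_entropy mu (p u) N.+1 <=
      lam * (C * (N.+1%:R * defect (p u) N + q ^+ N)) by rewrite ler_wpM2l// ltW.
  have h4 : lam * (C * (N.+1%:R * defect (p u) N + q ^+ N)) =
      2 * defect (p u) N + lam * C * q ^+ N.
    by rewrite /lam; field; rewrite nat1r !gt_eqF.
  have h5 : lam * b = lam * C * q ^+ N + K * q ^+ N.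
    by rewrite /lam /b; field; rewrite nat1r !gt_eqF.
  by lra.
(* Starting at t / 2 keeps to positive times, where the derivative is known; then lam t / 2 = t / (C
   (N + 1)). *)
have s0 : 0 < t / 2 by lra.
have st : t / 2 <= t by lra.
have := linear_differential_ineq
  (fun u u0 => is_derive_partial_entropy N mu0 sol u0 (pt u u0)) ineq s0 st.
have -> : - (lam * (t - t / 2)) = - (C^-1 * (t / N.+1%:R)).
  by rewrite /lam; field; rewrite nat1r !gt_eqF.
set e := expR _ => h.
have e0 : 0 < e by exact: expR_gt0.
have h1 : e * (partial_entropy mu (p (t / 2)) N.+1 - b) <= e * H.
  rewrite ler_pM2l//.
  have := partial_entropy_le N.+1 mu0 q0 q1 (ltW A0) (cp _ s0).
  have := ler_norm ((1 + ln (1 + mu%:R)) * A / (1 - q)); rewrite -/H.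
  by lra.
have h2 : 0 <= H * (N.+1%:R * q ^+ N) by rewrite !mulr_ge0.
have h3 : 0 <= (C + C * K) * e by rewrite mulr_ge0 ?ltW//; lra.
by lra.
Qed.

(** For N the integer part of sqrt t, both q^N and exp (- lam t / (N + 1)) decay exponentially in
    sqrt t; the latter because t / (N + 1) >= sqrt t - 1. *)
Lemma optimal_cutoff (R : realType) (q lam : R) : 0 < q -> q < 1 -> 0 < lam ->
  exists C1 C2 : R, [/\ 0 < C1, 0 < C2 & forall t : R, 0 < t -> exists N,
    N.+1%:R * q ^+ N + expR (- (lam * (t / N.+1%:R))) <=
      C1 * expR (- (C2 * Num.sqrt t))].
Proof.
move=> q0 q1 lam0; pose a := - ln q.
have a0 : 0 < a by rewrite oppr_gt0 ln_lt0// q0.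
exists (2 / a * expR a + expR lam), (Num.min (a / 2) lam); split.
- by rewrite addr_gt0 ?expR_gt0// mulr_gt0 ?expR_gt0// divr_gt0.
- by rewrite lt_min lam0 andbT divr_gt0.
move=> t t0; set s := Num.sqrt t.
have s0 : 0 < s by rewrite sqrtr_gt0.
have ts : t = s ^+ 2 by rewrite sqr_sqrtr// ltW.
have /truncn_itv /andP[Ns sN] := ltW s0; set N := Num.truncn s in Ns sN.
exists N; rewrite mulrDl.
have NN : N.+1%:R = N%:R + 1 :> R by rewrite -natr1.
have N0 : 0 <= N%:R :> R by [].
set C2 := Num.min _ _.
have C2a : C2 * s <= a / 2 * s by rewrite ler_pM2r// ge_min lexx.
have C2l : C2 * s <= lam * s by rewrite ler_pM2r// ge_min lexx orbT.
apply: lerD.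
  have -> : q ^+ N = expR (- (N%:R * a)).
    by rewrite -mulrN opprK expRM_natl lnK.
  (* The prefactor N + 1 is paid for with half of the rate a, whence a / 2 in [C2]. *)
  have h : N.+1%:R <= 2 / a * expR (a * N.+1%:R / 2).
    rewrite -ler_pdivrMl ?divr_gt0// invf_div.
    have := expR_ge1Dx (a * N.+1%:R / 2).
    by rewrite [a / 2 * _]mulrAC; lra.
  apply: le_trans (ler_wpM2r (expR_ge0 _) h) _.
  rewrite -!mulrA ler_pM2l// ler_pM2l ?invr_gt0// -!expRD ler_expR.
  have : a * s <= a * N.+1%:R by rewrite ler_pM2l// ltW.
  by rewrite NN; lra.
rewrite -expRD ler_expR.
have : lam * (s - 1) <= lam * (t / N.+1%:R).
  rewrite ler_pM2l// ler_pdivlMr// NN ts; nra.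
move: (t / N.+1%:R) => z h.
by lra.
Qed.

(** * Passage to the infinite sums *)

Lemma nneseries_geometric_tail (R : realType) (f : nat -> R) (s A q : R) N :
  0 < q -> q < 1 -> 0 <= A -> (forall n, 0 <= f n) ->
  (forall n, f n <= A * q ^+ n) -> (\sum_(0 <= n <oo) (f n)%:E = s%:E)%E ->
  0 <= s - \sum_(n < N) f n <= A / (1 - q) * q ^+ N.
Proof.
move=> q0 q1 A0 f0 fA fs; rewrite subr_ge0 lerBlDr; apply/andP; split.
  rewrite -lee_fin -fs -sumEFin -(big_mkord xpredT (fun n => (f n)%:E)).
  by apply: nneseries_lim_ge => n _ _; rewrite lee_fin.
rewrite -lee_fin -fs; apply: lime_le.
  by apply: is_cvg_nneseries => n _ _; rewrite lee_fin.
exists N => // m /= /subnKC <-.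
rewrite big_mkord sumEFin lee_fin addrC.
apply: le_trans (sum_geometric_tail N (m - N) q1 fA) _.
rewrite lerD2l; apply: ler_wpM2l; first by rewrite divr_ge0// subr_ge0 ltW.
by rewrite gerBl exprn_ge0// ltW.
Qed.

(** The power q^n is the smallest of the first n + 1 terms of the geometric series. *)
Lemma natrS_mul_expr_le (R : realType) (q : R) n : 0 < q -> q < 1 ->
  n.+1%:R * q ^+ n <= (1 - q)^-1.
Proof.
move=> q0 q1.
have -> : n.+1%:R * q ^+ n = \sum_(i < n.+1) q ^+ n.
  by rewrite sumr_const card_ord mulr_natl.
apply: le_trans (_ : \sum_(i < n.+1) q ^+ i <= _).
  apply: ler_sum => i _; rewrite ler_wiXn2l// ?ltW// -ltnS; exact: ltn_ord.
rewrite -[leRHS]mul1r; apply: (@sum_geometric_le R (GRing.exp q)) => // k.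
by rewrite mul1r.
Qed.

Lemma Nmul_ln_le_sqrt (R : realType) (x : R) : 0 <= x ->
  - (x * ln x) <= 2 * Num.sqrt x.
Proof.
move=> x0; have [->|xn] := eqVneq x 0; first by rewrite mul0r oppr0 mulr_ge0 ?sqrtr_ge0.
set y := Num.sqrt x; have xp : 0 < x by rewrite lt_def xn.
have y0 : 0 < y by rewrite sqrtr_gt0.
have xy : x = y ^+ 2 by rewrite sqr_sqrtr.
have l := ler_lnV y0.
rewrite xy lnXn// -(mulr_natl (ln y)).
have : y ^+ 2 * (1 - y^-1) <= y ^+ 2 * ln y by rewrite ler_pM2l// exprn_gt0.
have -> : y ^+ 2 * (1 - y^-1) = y ^+ 2 - y by field; rewrite gt_eqF.
have : 0 <= y ^+ 2 by exact: sqr_ge0.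
by lra.
Qed.

Lemma controlled_exp_moment (R : realType) mu (K M : R) : (0 < mu)%N ->
  1 < K -> 0 < M ->
  exists A q : R, [/\ 0 < A, 1 - (2 * (mu%:R + 1))^-1 <= q, q < 1 &
    forall p, V mu p -> (exp_moment K p <= M%:E)%E -> controlled mu A q p].
Proof.
move=> mu0 K1 M0.
have m1 : (1 : R) <= mu%:R by rewrite ler1n.
(* With r = K^(-1/4), the moment bound gives p_n <= M r^(4 n). Two factors r^n pay for the weight (n
   + 1)^2, and the square root bounding - p_n ln p_n still leaves r^(2 n). *)
pose k := Num.sqrt (Num.sqrt K).
have sqrt1 (x : R) : 1 < x -> 1 < Num.sqrt x.
  by move=> x1; rewrite -[ltLHS]sqrtr1 ltr_sqrt// (lt_trans ltr01).
have k1 : 1 < k := sqrt1 _ (sqrt1 _ K1).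
have kK : k ^+ 4 = K.
  by rewrite (exprM k 2 2) !sqr_sqrtr ?sqrtr_ge0//; lra.
pose r := k^-1.
have r0 : 0 < r by rewrite invr_gt0; lra.
have r1 : r < 1 by rewrite invf_lt1; lra.
have rK : r ^+ 4 = K^-1 by rewrite /r exprVn kK.
pose c : R := (2 * (mu%:R + 1))^-1.
have c0 : 0 < c by rewrite invr_gt0; lra.
pose q := Num.max (1 - c) r.
have rq : r <= q by rewrite le_max lexx orbT.
have q1 : q < 1 by rewrite gt_max r1 andbT; lra.
(* The two summands bound the weighted terms and - p_n ln p_n; the division by 1 - r in [A] pays for
   summing the tails. *)
pose A0 := M * (1 - r)^-1 ^+ 2 + 2 * Num.sqrt M.
have d0 : 0 < (1 - r)^-1 by rewrite invr_gt0; lra.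
have s0 : 0 < Num.sqrt M by rewrite sqrtr_gt0.
have B0 : 0 < M * (1 - r)^-1 ^+ 2 by rewrite mulr_gt0// exprn_gt0.
have A00 : 0 < A0 by rewrite /A0; lra.
pose A := A0 / (1 - r).
have A0A : A0 <= A by rewrite /A ler_pdivlMr; nra.
have A0' : 0 <= A by apply: ltW; exact: lt_le_trans A0A.
have rN n : 0 <= r ^+ n by rewrite exprn_ge0// ltW.
have rqn n : r ^+ n <= q ^+ n.
  by apply: lerXn2r; rewrite ?nnegrE// ltW// (lt_le_trans r0).
have up n : A0 * r ^+ n <= A * q ^+ n by apply: ler_pM => //; exact: ltW.
exists A, q; split=> //.
- exact: lt_le_trans A0A.
- by rewrite le_max lexx.
move=> p [p0 p1 pm] eM.
have K0 : 0 < K := lt_trans ltr01 K1.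
have pM n : p n <= M * r ^+ (4 * n).
  have : ((K ^+ n * p n)%:E <= M%:E)%E.
    apply: le_trans eM.
    have : (\sum_(0 <= i < n.+1) (K ^+ i * p i)%:E <= exp_moment K p)%E.
      apply: nneseries_lim_ge => i _ _.
      by rewrite lee_fin mulr_ge0// exprn_ge0// ltW.
    apply: le_trans; rewrite big_nat_recr//= leeDr// sume_ge0// => i _.
    by rewrite lee_fin mulr_ge0// exprn_ge0// ltW.
  by rewrite lee_fin exprM rK exprVn ler_pdivlMr ?exprn_gt0// mulrC.
have p2 n : n.+1%:R ^+ 2 * p n <= M * (1 - r)^-1 ^+ 2 * r ^+ n.
  apply: le_trans (_ : n.+1%:R ^+ 2 * (M * r ^+ (4 * n)) <= _).
    by rewrite ler_wpM2l ?sqr_ge0.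
  have -> : n.+1%:R ^+ 2 * (M * r ^+ (4 * n)) =
     M * ((n.+1%:R * r ^+ n) ^+ 2 * r ^+ (2 * n)).
    have -> : r ^+ (4 * n) = (r ^+ n) ^+ 2 * r ^+ (2 * n).
      by rewrite -exprM (mulnC n) -exprD -mulnDl.
    by rewrite exprMn mulrCA !mulrA.
  rewrite -mulrA ler_pM2l//; apply: ler_pM; [exact: sqr_ge0|by []| |].
    apply: lerXn2r; rewrite ?nnegrE ?natrS_mul_expr_le ?mulr_ge0//.
    exact: ltW.
  by rewrite ler_wiXn2l// ?ltW// leq_pmull.
have p3 n : n.+1%:R ^+ 2 * p n <= A0 * r ^+ n.
  apply: le_trans (p2 n) _; rewrite ler_wpM2r//.
  by rewrite /A0; lra.
have np n : n%:R <= n.+1%:R ^+ 2 :> R.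
  by have n0 : 0 <= n%:R :> R := ler0n R n; rewrite -(natr1 n); nra.
have n1 n : 1 <= n.+1%:R ^+ 2 :> R.
  by rewrite exprn_ege1// ler1n.
split=> //.
- by move=> n; apply: le_trans (up n).
- move=> n; apply: le_trans (Nmul_ln_le_sqrt (p0 n)) _.
  apply: le_trans (up n).
  apply: le_trans (_ : 2 * (Num.sqrt M * r ^+ n) <= _).
    rewrite ler_pM2l//.
    apply: le_trans (_ : Num.sqrt (M * r ^+ (4 * n)) <= _).
      by rewrite ler_wsqrtr.
    rewrite sqrtrM; last exact: ltW.
    rewrite ler_pM2l//.
    have -> : (4 * n = (2 * n) * 2)%N by rewrite mulnAC.
    rewrite exprM sqrtr_sqr ger0_norm//.
    by rewrite ler_wiXn2l// ?ltW// leq_pmull.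
  rewrite mulrA ler_wpM2r//.
  by rewrite /A0; lra.
- move=> N.
  have h n : p n <= A0 * r ^+ n.
    by apply: le_trans (p3 n); rewrite ler_peMl.
  have /andP[-> h2] := nneseries_geometric_tail N r0 r1 (ltW A00) p0 h p1.
  by apply: le_trans h2 _; apply: ler_wpM2l.
- move=> N.
  have h n : n%:R * p n <= A0 * r ^+ n.
    by apply: le_trans (p3 n); rewrite ler_wpM2r.
  have h0 n : 0 <= n%:R * p n by apply: mulr_ge0.
  have /andP[-> h2] := nneseries_geometric_tail N r0 r1 (ltW A00) h0 h pm.
  by apply: le_trans h2 _; apply: ler_wpM2l.
Qed.

(** The terms may be negative, so convergence comes from absolute domination by a geometric series
    of reals. *)
Lemma relative_entropy_le (R : realType) mu (A q : R) p N : (0 < mu)%N ->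
  0 < q -> q < 1 -> 0 <= A -> controlled mu A q p ->
  (relative_entropy p (pstar R mu) <=
    (partial_entropy mu p N +
     (1 + ln (1 + mu%:R)) * A / (1 - q) * q ^+ N)%:E)%E.
Proof.
move=> mu0 q0 q1 A0 cp.
have p0 : forall n, 0 <= p n by case: cp.
pose f n := p n * ln (p n / pstar R mu n).
(* For p_n = 0 both conventions give 0, although [lne 0] is -oo and [ln 0] is a real number. *)
have fE n : ((p n)%:E * lne ((p n)%:E / (pstar R mu n)%:E))%E = (f n)%:E.
  rewrite inver gt_eqF ?pstar_gt0// -EFinM.
  have [pz|pn] := eqVneq (p n) 0; first by rewrite /f pz !mul0r mul0e.
  by rewrite lne_EFin ?divr_gt0 ?pstar_gt0// lt_def pn p0.
set B := (1 + ln (1 + mu%:R)) * A.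
have B0 : 0 <= B by rewrite mulr_ge0// addr_ge0// ln_ge0// lerDl.
have fB n : `|f n| <= B * q ^+ n by exact: entropy_term_bounds.
have cvgf : cvgn (series f).
  apply: normed_cvg; apply: (@series_le_cvg R (fun n => `|f n|) (geometric B q)) => [n|n|n|].
  - exact: normr_ge0.
  - by apply: le_trans (fB n); exact: normr_ge0.
  - exact: fB.
  - by apply: is_cvg_geometric_series; rewrite ger0_norm// ltW.
have sE : (fun n => (\sum_(0 <= i < n)
    ((p i)%:E * lne ((p i)%:E / (pstar R mu i)%:E)))%E) = EFin \o series f.
  by apply/funext => n /=; rewrite -sumEFin; apply: eq_bigr => i _; exact: fE.
rewrite /relative_entropy sE EFin_lim// lee_fin; apply: limr_le => //.
exists N => // m /= /subnKC <-; rewrite seriesEord/=.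
have fB' n : f n <= B * q ^+ n by exact: le_trans (ler_norm _) (fB n).
apply: le_trans (sum_geometric_tail N (m - N) q1 fB') _.
rewrite lerD2l; apply: ler_wpM2l; first by rewrite divr_ge0// subr_ge0 ltW.
by rewrite gerBl exprn_ge0// ltW.
Qed.

(** When exactly one of [a] and [b] vanishes, the right side is +oo; when both do, both sides are
    0. *)
Lemma dissipation_term_ge (R : realType) (a b : R) : 0 <= a -> 0 <= b ->
  ((2 * (Num.sqrt a - Num.sqrt b) ^+ 2)%:E <=
    (a - b)%:E * (lne a%:E - lne b%:E))%E.
Proof.
move=> a0 b0.
have [->|an] := eqVneq a 0; have [->|bn] := eqVneq b 0.
- by rewrite !subrr expr0n/= mulr0 mul0e.
- have bp : 0 < b by rewrite lt_def bn.
  by rewrite le0_lneNy// lne_EFin//= sub0r lt0_muleNy ?leey// lte_fin oppr_lt0.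
- have ap : 0 < a by rewrite lt_def an.
  by rewrite (@le0_lneNy _ 0%:E)// lne_EFin//= subr0 gt0_muley ?leey// lte_fin.
- have ap : 0 < a by rewrite lt_def an.
  have bp : 0 < b by rewrite lt_def bn.
  by rewrite !lne_EFin// -EFinB -EFinM lee_fin hellinger_le_dissipation.
Qed.

Lemma defect_le_dissipation (R : realType) (p : nat -> R) N :
  (forall n, 0 <= p n) -> 0 <= rbar p ->
  ((2 * defect p N)%:E <= dissipation p)%E.
Proof.
move=> p0 r0.
have t0 n := dissipation_term_ge (mulr_ge0 r0 (p0 n)) (p0 n.+1).
apply: (@le_trans _ _ (\sum_(0 <= n < N) ((rbar p * p n - p n.+1)%:E *
      (lne (rbar p * p n)%:E - lne (p n.+1)%:E)))%E).
  rewrite /defect mulr_sumr -sumEFin -(big_mkord xpredT (fun n =>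
    (2 * (Num.sqrt (rbar p * p n) - Num.sqrt (p n.+1)) ^+ 2)%:E)).
  by apply: lee_sum => n _; exact: t0.
apply: nneseries_lim_ge => n _ _; apply: le_trans (t0 n).
by rewrite lee_fin mulr_ge0// sqr_ge0.
Qed.

(** * The entropy-dissipation inequality and the decay of the full entropy *)

Lemma relative_entropy_le_cutoff (R : realType) mu (A q : R) :
  (0 < mu)%N -> 0 < A -> 0 < q -> 1 - (2 * (mu%:R + 1))^-1 <= q -> q < 1 ->
  exists2 C : R, 0 < C & forall p N, controlled mu A q p ->
    (relative_entropy p (pstar R mu) <=
      (C * (N.+1%:R * defect p N + q ^+ N))%:E)%E.
Proof.
move=> mu0 A0 q0 cq q1.
have [C C0 CP] := entropy_le_defect mu0 A0 cq q1.
set T := (1 + ln (1 + mu%:R)) * A / (1 - q).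
have T0 : 0 <= T.
  by rewrite divr_ge0 ?subr_ge0 1?ltW// mulr_gt0// ltr_wpDr// ln_ge0// lerDl.
exists (C + T); first lra.
move=> p N cp; apply: le_trans (relative_entropy_le N.+1 mu0 q0 q1 (ltW A0) cp) _.
rewrite lee_fin -/T.
have qN : 0 <= q ^+ N by rewrite exprn_ge0// ltW.
have h1 : T * q ^+ N.+1 <= T * q ^+ N.
  by rewrite ler_wpM2l// exprS ler_piMl// ltW.
have h2 : 0 <= T * (N.+1%:R * defect p N).
  by do 2!apply: mulr_ge0 => //; exact: defect_ge0.
have := CP p N cp; lra.
Qed.

Lemma relative_entropy_le_dissipation (R : realType) mu (A q : R) :
  (0 < mu)%N -> 0 < A -> 0 < q -> 1 - (2 * (mu%:R + 1))^-1 <= q -> q < 1 ->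
  exists2 C : R, 0 < C & forall p, controlled mu A q p ->
    (relative_entropy p (pstar R mu) <=
      C%:E * (dissipation p * maxe 1 `|lne (dissipation p)^-1|))%E.
Proof.
move=> mu0 A0 q0 cq q1.
have [C C0 CP] := relative_entropy_le_cutoff mu0 A0 q0 cq q1.
pose a := - ln q.
have a0 : 0 < a by rewrite oppr_gt0 ln_lt0// q0.
exists (C * (a^-1 + 3)); first by rewrite mulr_gt0// addr_gt0// invr_gt0.
move=> p cp.
have /andP[r0 _] := controlled_rbar cp.
have p0 : forall n, 0 <= p n by case: cp.
have := fun N => defect_le_dissipation N p0 r0.
have C'0 : 0 < C * (a^-1 + 3) by rewrite mulr_gt0// addr_gt0// invr_gt0.
case: (dissipation p) => [d||] Dd; last 2 first.
- have m0 (x : \bar R) : (0 < maxe 1 x)%E by rewrite lt_max lte01.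
  by rewrite (gt0_mulye (m0 _)) gt0_muley ?leey// lte_fin.
- by have := Dd 0%N.
have {}Dd N : 2 * defect p N <= d by rewrite -lee_fin.
have d0 : 0 <= d by apply: le_trans (Dd 0%N); rewrite mulr_ge0// defect_ge0.
have {}CP N : (relative_entropy p (pstar R mu) <=
    (C * (N.+1%:R * d + q ^+ N))%:E)%E.
  apply: le_trans (CP p N cp) _; rewrite lee_fin ler_pM2l// lerD2r ler_wpM2l//.
  by have := Dd N; have := defect_ge0 p N; lra.
(* If d = 0 the right side is 0, as 0 times +oo is 0; letting the cutoff grow shows that the entropy
   is at most 0. *)
have [dz|dn] := eqVneq d 0.
  rewrite dz mul0e mule0; apply/lee_addgt0Pr => e e0; rewrite add0e.
  have [N qe] := exprn_le_small q0 q1 C0 e0.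
  by apply: le_trans (CP N) _; rewrite lee_fin dz mulr0 add0r.
have dp : 0 < d by rewrite lt_def dn.
rewrite inver (negbTE dn) lne_EFin ?invr_gt0// lnV ?posrE//.
rewrite [abse _]/= -EFin_max -!EFinM normrN.
(* The cutoff N + 1, with N the integer part of l / a, ensures q^(N+1) <= d, and (N + 2) d + d <= (l
   / a + 3) d. The maximum with 1 in the statement absorbs the constant 3 for d near 1. *)
pose l := Num.max 0 (- ln d).
have l0 : 0 <= l by rewrite le_max lexx.
have la0 : 0 <= l / a by rewrite divr_ge0// ltW.
have /truncn_itv /andP[] := la0; set N := Num.truncn _ => N1 N2.
apply: le_trans (CP N.+1) _; rewrite lee_fin -mulrA ler_pM2l//.
have qd : q ^+ N.+1 <= d.
  have -> : q ^+ N.+1 = expR (- (N.+1%:R * a)).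
    by rewrite -mulrN opprK expRM_natl lnK.
  rewrite -[leRHS]lnK ?posrE// ler_expR lerNl.
  apply: le_trans (_ : l <= _); first by rewrite le_max lexx orbT.
  by rewrite -ler_pdivrMr// ltW.
set m := Num.max 1 _.
have m1 : 1 <= m by rewrite le_max lexx.
have lm : l <= m.
  rewrite ge_max (le_trans ler01 m1)/=.
  by rewrite (le_trans (ler_norm _))// normrN le_max lexx orbT.
have lam : l / a <= a^-1 * m by rewrite mulrC ler_wpM2l// invr_ge0 ltW.
apply: le_trans (_ : (l / a + 3) * d <= _).
  have Nd : N%:R * d <= l / a * d by rewrite ler_wpM2r.
  have -> : N.+2%:R = N%:R + 2 :> R by rewrite -addn2 natrD.
  by rewrite !mulrDl; move: (l / a * d) (N%:R * d) (q ^+ _) Nd qd => *; lra.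
rewrite mulrCA (mulrC d) ler_pM2r// mulrDl.
by apply: lerD lam _; rewrite ler_peMr.
Qed.

Lemma relative_entropy_decay (R : realType) mu (A q : R) (p : R -> nat -> R) :
  (0 < mu)%N -> 0 < A -> 0 < q -> 1 - (2 * (mu%:R + 1))^-1 <= q -> q < 1 ->
  mean_field_solution p -> (forall t : R, 0 <= t -> controlled mu A q (p t)) ->
  exists C1 C2 : R, [/\ 0 < C1, 0 < C2 & forall t : R, 0 <= t ->
    (relative_entropy (p t) (pstar R mu) <=
      (C1 * expR (- (C2 * Num.sqrt t)))%:E)%E].
Proof.
move=> mu0 A0 q0 cq q1 sol cp.
have [C [lam [C0 lam0 CP]]] :=
  partial_entropy_decay mu0 A0 cq q1 sol (fun t t0 => cp t (ltW t0)).
have [C1 [C2 [C10 C20 cut]]] := optimal_cutoff q0 q1 lam0.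
set T := (1 + ln (1 + mu%:R)) * A / (1 - q).
have T0 : 0 <= T.
  by rewrite divr_ge0 ?subr_ge0 1?ltW// mulr_gt0// ltr_wpDr// ln_ge0// lerDl.
exists ((C + T) * C1 + T); exists C2.
have CT0 : 0 < (C + T) * C1 by rewrite mulr_gt0//; lra.
split=> //; first lra.
(* The decay estimate covers t > 0; at t = 0 the tail bound with an empty partial sum suffices. *)
move=> t; rewrite le_eqVlt => /predU1P[<-|t0].
  rewrite sqrtr0 mulr0 oppr0 expR0 mulr1.
  apply: le_trans (relative_entropy_le 0 mu0 q0 q1 (ltW A0) (cp 0 (lexx 0))) _.
  by rewrite lee_fin /partial_entropy big_ord0 add0r expr0 mulr1 -/T; lra.
have [N hN] := cut t t0.
apply: le_trans
  (relative_entropy_le N.+1 mu0 q0 q1 (ltW A0) (cp t (ltW t0))) _.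
rewrite lee_fin -/T.
have h1 := CP t N t0.
set X := _ + expR _ in hN h1; set e := expR _ in hN *.
have e0 : 0 <= e by exact: expR_ge0.
have qX : q ^+ N.+1 <= X.
  rewrite /X exprS; have qN : 0 <= q ^+ N by rewrite exprn_ge0// ltW.
  have : q * q ^+ N <= N.+1%:R * q ^+ N.
    by rewrite ler_wpM2r// (le_trans (ltW q1))// ler1n.
  by have := expR_ge0 (- (lam * (t / N.+1%:R))); lra.
have h2 : T * q ^+ N.+1 <= T * X by rewrite ler_wpM2l.
have h3 : (C + T) * X <= (C + T) * (C1 * e) by rewrite ler_wpM2l//; lra.
have h4 : 0 <= T * e by rewrite mulr_ge0.
by lra.
Qed.

Theorem theorem4 (R : realType) (mu : nat) (K : R) (p : R -> nat -> R) :
  (0 < mu)%N ->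
  1 < K ->
  mean_field_solution p ->
  (forall t : R, 0 <= t -> V mu (p t)) ->
  propagates_exp_moment K p ->
  (exp_moment K (p 0%R) < +oo)%E ->
  (forall tstar : R, is_tstar mu K p tstar ->
    (exists2 C : R, 0 < C & forall t : R, tstar <= t ->
      (relative_entropy (p t) (pstar R mu) <=
        C%:E * (dissipation (p t) * maxe 1 `|lne (dissipation (p t))^-1|))%E) /\
    (exists C1 C2 : R, [/\ 0 < C1, 0 < C2 & forall t : R, tstar <= t ->
      (relative_entropy (p t) (pstar R mu) <=
        (C1 * expR (- (C2 * Num.sqrt t)))%:E)%E])) /\
  (exists C1 C2 : R, [/\ 0 < C1, 0 < C2 & forall t : R, 0 < t ->
    (relative_entropy (p t) (pstar R mu) <=
      (C1 * expR (- (C2 * Num.sqrt t)))%:E)%E]).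
Proof.
move=> mu0 K1 sol VP prop e0.
have {prop} := prop e0; set S := ereal_sup _ => Sfin.
have supS (t : R) : 0 < t -> (exp_moment K (p t) <= S)%E.
  by move=> t0; apply: ereal_sup_ubound; exists t.
have mom0 (t : R) : 0 <= t -> (0 <= exp_moment K (p t))%E.
  move=> t0; have [p0 _ _] := VP t t0; apply: nneseries_ge0 => n _ _.
  by rewrite lee_fin mulr_ge0// exprn_ge0// (le_trans ler01)// ltW.
have S0 : (0 <= S)%E := le_trans (mom0 1 ler01) (supS 1 ltr01).
have Sf : S \is a fin_num by rewrite ge0_fin_numE.
have ef : exp_moment K (p 0) \is a fin_num by rewrite ge0_fin_numE// mom0.
(* The supremum runs over t > 0 only, so the initial moment is added; the 1 makes [M] positive. *)
pose M := 1 + fine S + fine (exp_moment K (p 0)).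
have fS : 0 <= fine S by rewrite fine_ge0.
have fe : 0 <= fine (exp_moment K (p 0)) by rewrite fine_ge0// mom0.
have M0 : 0 < M by rewrite /M; lra.
have momM (t : R) : 0 <= t -> (exp_moment K (p t) <= M%:E)%E.
  rewrite le_eqVlt => /predU1P[<-|t0].
    by rewrite -(fineK ef) lee_fin /M; lra.
  by apply: le_trans (supS t t0) _; rewrite -(fineK Sf) lee_fin /M; lra.
have [A [q [A0 cq q1 ctrl]]] := controlled_exp_moment mu0 K1 M0.
have cp (t : R) : 0 <= t -> controlled mu A q (p t).
  by move=> t0; apply: ctrl; [exact: VP|exact: momM].
have q0 : 0 < q.
  have m1 : (1 : R) <= mu%:R by rewrite ler1n.
  by apply: lt_le_trans cq; rewrite subr_gt0 invf_lt1; lra.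
have [C1 [C2 [C10 C20 decay]]] := relative_entropy_decay mu0 A0 q0 cq q1 sol cp.
have [C C0 CP] := relative_entropy_le_dissipation mu0 A0 q0 cq q1.
split; last by exists C1, C2; split=> // t /ltW; exact: decay.
move=> tstar [ts0 _]; split.
  by exists C => // t tt; apply: CP; apply: cp; exact: le_trans tt.
by exists C1, C2; split=> // t tt; apply: decay; exact: le_trans tt.
Qed.
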